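(* Let $L=d_z^n+a_{n-1}d_z^{n-1}+\cdots+a_1d_z+a_0$ over $C(z)$ have a finite differential Galois group $G$ and Picard–Vessiot field $K\subset\overline{C(z)}$. Consider the $C(z)$-algebra homomorphism $\phi:R_0=C(z)[X_1,\dots,X_n]\to K$ which sends $X_1,\dots,X_n$ to a basis of the solution space of $L$ in $K$. Let $G$ act $C(z)$-linearly on $R_0$ by algebra automorphisms via the $C$-linear action on $CX_1+\cdots+CX_n$ which coincides (under $\phi$) with the action of $G$ on the solution space of $L$. Let $ev:C[X_1,\dots,X_n]^G\to C(z)$ be the restriction of $\phi$, and write $C[X_1,\dots,X_n]^G=C[\phi_1,\dots,\phi_r]$ for certain homogeneous elements $\phi_k$. Then $\ker(\phi)$ is generated, as an ideal of $R_0$, by $\{\phi_k-ev(\phi_k)\mid k=1,\dots,r\}$.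
   Context: $C$ is an algebraically closed field of characteristic zero, $C(z)$ is the differential field with derivation $d_z=\frac{d}{dz}$, and $\overline{C(z)}$ is its algebraic closure. All $a_i\in C(z)$. The Picard–Vessiot field $K$ is the subfield of $\overline{C(z)}$ generated over $C(z)$ by the solutions of $L$ and their derivatives; it is a finite Galois extension of $C(z)$ with Galois group $G$, and the solution space of $L$ in $K$ has $C$-dimension $n$. The map $ev$ (the evaluation of the invariants) takes values in $K^G=C(z)$ because $\phi$ is $G$-equivariant. *)

(* Defs.v *)
From HB Require Import structures.
From mathcomp Require Import all_boot all_order all_algebra all_fingroup all_field.
From mathcomp Require Import fraction generic_quotient mpoly.
From mathcomp Require Import ring.

Set Implicit Arguments.
Unset Strict Implicit.
Unset Printing Implicit Defensive.

Import GRing.Theory.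
Local Open Scope ring_scope.
Local Open Scope quotient_scope.

Notation ratfun C := {fraction {poly C}}.

Section RationalFunctions.
Variable C : fieldType.
Implicit Types (f : ratfun C) (p q : {poly C}).

Definition ratconst (c : C) : ratfun C := FracField.tofrac c%:P.

Fact ratconst_is_zmod_morphism : zmod_morphism ratconst.
Proof. by move=> c d; rewrite /ratconst polyCB tofracB. Qed.

Fact ratconst_is_monoid_morphism : monoid_morphism ratconst.
Proof.
by split=> [|c d]; rewrite /ratconst ?polyC1 ?tofrac1 // polyCM tofracM.
Qed.

HB.instance Definition _ :=
  GRing.isZmodMorphism.Build C (ratfun C) ratconst ratconst_is_zmod_morphism.
HB.instance Definition _ :=
  GRing.isMonoidMorphism.Build C (ratfun C) ratconst
    ratconst_is_monoid_morphism.

(* The derivation d/dz, by the quotient rule applied to the representative of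
   f chosen by repr; dz_frac shows that the choice does not matter. *)
Definition dz f : ratfun C :=
  let: p := \n_(repr f) in
  let: q := \d_(repr f) in
  FracField.tofrac (p^`() * q - p * q^`()) / FracField.tofrac (q ^+ 2).

Lemma ratfun_repr f :
  f = FracField.tofrac \n_(repr f) / FracField.tofrac \d_(repr f).
Proof.
have d0 := denom_ratioP (repr f).
apply: (@mulIf _ (FracField.tofrac \d_(repr f))); first by rewrite tofrac_eq0.
rewrite divfK ?tofrac_eq0 // -{1}[f]reprK; move: (repr f) d0 => x d0.
rewrite -[LHS]/(FracField.mul (\pi_(ratfun C) x) (FracField.tofrac \d_x)).
rewrite !piE; apply/eqmodP; rewrite /= FracField.equivfE /FracField.mulf.
by rewrite !numden_Ratio ?mulf_neq0 ?oner_eq0 // !mulr1 mulrC.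
Qed.

Lemma dz_frac p q : q != 0 ->
  dz (FracField.tofrac p / FracField.tofrac q) =
    FracField.tofrac (p^`() * q - p * q^`()) / FracField.tofrac (q ^+ 2).
Proof.
move=> q0; set f := _ / _; rewrite /dz.
have d0 := denom_ratioP (repr f); have := ratfun_repr f.
move: (\n_(repr f)) (\d_(repr f)) d0 => a b b0; rewrite {}/f => /eqP.
rewrite eqr_div ?tofrac_eq0 // -!tofracM tofrac_eq => /eqP e.
apply/eqP; rewrite eqr_div ?tofrac_eq0 ?expf_neq0 // -!tofracM tofrac_eq.
have /(congr1 (fun u => u * (b * q))) e' := congr1 (@deriv C) e.
rewrite !derivM in e'.
have e1 : a * q = p * b by rewrite e.
apply/eqP; apply: (@mulIf _ 1); first exact: oner_neq0.
have -> : (a^`() * b - a * b^`()) * q ^+ 2 * 1 =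
  (a^`() * q + a * q^`()) * (b * q) - (a * q) * (b * q^`() + b^`() * q).
  by ring.
have -> : (p^`() * q - p * q^`()) * b ^+ 2 * 1 =
  (p^`() * b + p * b^`()) * (b * q) - (p * b) * (b * q^`() + b^`() * q).
  by ring.
by rewrite -e' e1.
Qed.

End RationalFunctions.

Section PicardVessiot.
Variables (C : fieldType) (K : splittingFieldType (ratfun C)).
Implicit Types (D : K -> K) (x y : K).

Definition extends_dz D : Prop :=
  [/\ {morph D : x y / x + y},
      forall x y, D (x * y) = D x * y + x * D y
    & forall f : ratfun C, D f%:A = (dz f)%:A].

(* a 0, ..., a (n-1) are the coefficients below the leading term of the monic
   operator d^n + a_{n-1} d^{n-1} + ... + a_1 d + a_0. *)
Definition diffop D n (a : 'I_n -> ratfun C) y : K :=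
  iter n D y + \sum_(i < n) a i *: iter i D y.

Definition solution D n (a : 'I_n -> ratfun C) y : Prop := diffop D a y = 0.

Definition constK (c : C) : K := (ratconst c)%:A.

Definition solution_basis D n (a : 'I_n -> ratfun C) (y : 'I_n -> K) : Prop :=
  [/\ forall i, solution D a (y i),
      forall c : 'I_n -> C, \sum_i constK (c i) * y i = 0 -> forall i, c i = 0
    & forall v, solution D a v ->
        exists c : 'I_n -> C, v = \sum_i constK (c i) * y i].

(* Every {subfield K} contains C(z), so this says that K is generated over C(z)
   by the solutions and all their derivatives. *)
Definition generated_by_solutions D n (a : 'I_n -> ratfun C) : Prop :=
  forall E : {subfield K},
    (forall v, solution D a v -> forall k, iter k D v \in E) ->
    (E : {vspace K}) = fullv.

(* K is a finite extension by its type, so it embeds in the algebraic closure of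
   C(z). *)
Definition picard_vessiot D n (a : 'I_n -> ratfun C) : Prop :=
  [/\ extends_dz D,
      generated_by_solutions D a
    & exists y : 'I_n -> K, solution_basis D a y].

(* gal_of {:K} is the group of all C(z)-automorphisms of K. *)
Definition diff_galois_group D (G : {group gal_of {:K}}) : Prop :=
  forall g : gal_of {:K}, g \in G <-> forall x, g (D x) = D (g x).

Definition represents n (y : 'I_n -> K) (G : {group gal_of {:K}})
    (rho : gal_of {:K} -> 'M[C]_n) : Prop :=
  forall g, g \in G -> forall i, g (y i) = \sum_j constK (rho g i j) * y j.

Definition incl_mpoly n (p : {mpoly C[n]}) : {mpoly (ratfun C)[n]} :=
  map_mpoly (@ratconst C) p.

(* The C(z)-algebra endomorphism of C(z)[X_1, ..., X_n] with
   X_i |-> \sum_j M i j X_j. *)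
Definition lin_act n (M : 'M[C]_n) (p : {mpoly (ratfun C)[n]}) :
    {mpoly (ratfun C)[n]} :=
  p \mPo [tuple \sum_j ratconst (M i j) *: 'X_j | i < n].

Definition invariant n (G : {group gal_of {:K}})
    (rho : gal_of {:K} -> 'M[C]_n) (p : {mpoly C[n]}) : Prop :=
  forall g, g \in G -> lin_act (rho g) (incl_mpoly p) = incl_mpoly p.

Definition sol_eval n (y : 'I_n -> K) (p : {mpoly (ratfun C)[n]}) : K :=
  mmap (in_alg K) y p.

(* The element f of C(z) with f%:A = x, when x lies in the subfield C(z). *)
Definition to_base (x : K) : ratfun C := coord [tuple (1%R : K)] ord0 x.

Lemma to_baseK x : x \in 1%VS -> (to_base x)%:A = x.
Proof.
move=> x1; have x1' : x \in <<[tuple (1%R : K)]>>%VS by rewrite span_seq1.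
by rewrite [in RHS](coord_span x1') big_ord1.
Qed.

Lemma to_base_alg f : to_base f%:A = f.
Proof.
have := to_baseK (rpredZ f (mem1v 1%AS)).
by move/eqP; rewrite -subr_eq0 -scalerBl scaler_eq0 oner_eq0 orbF subr_eq0 => /eqP.
Qed.

Definition ev n (y : 'I_n -> K) (p : {mpoly C[n]}) : ratfun C :=
  to_base (sol_eval y (incl_mpoly p)).

(* C[X_1, ..., X_n]^G = C[P_1, ..., P_r] with every P_k homogeneous. *)
Definition homogeneous_generators n (G : {group gal_of {:K}})
    (rho : gal_of {:K} -> 'M[C]_n) r (P : r.-tuple {mpoly C[n]}) : Prop :=
  (forall k, exists d, tnth P k \is d.-homog) /\
  (forall p, invariant G rho p <-> exists q : {mpoly C[r]}, p = q \mPo P).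

End PicardVessiot.

(* Main.v *)
From HB Require Import structures.
Require Import Defs.
From mathcomp Require Import all_boot all_order all_algebra all_fingroup all_field.
From mathcomp Require Import fraction mpoly.

Import GRing.Theory.
Local Open Scope ring_scope.

(** Write F = C(z), R = F[X_1, ..., X_n], phi for the evaluation of R at the
    basis y, and I for the ideal of R generated by the P_k - ev(P_k).

    All F-automorphisms of K commute with the derivation, because the extension
    of d/dz to K is unique (gal_derivation_commute); so the group G is the whole
    Galois group, K^G = F, and phi(P_k) = ev(P_k), whence phi(I) = 0.  Moreover
    only the identity fixes y_1, ..., y_n, since K is generated by the solutions
    and their derivatives (gal_trivial_on_solutions).  Geometrically y has a
    free orbit under G, so the quotient A^n -> A^n / G is etale there, and its
    fibre, which I defines, is the reduced orbit of y, that is Spec K.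

    The converse inclusion ker phi <= I makes this explicit and stays over F.
    The trace Tr p = sum over g of (g p) is congruent to a constant modulo I:
    by F-linearity it is enough to see this for a monomial, whose trace lies in
    C[X]^G = C[P_1, ..., P_r] (act_trace_constant_mod).  As phi(I) = 0, that
    constant is phi(Tr p); in particular Tr p is in I as soon as phi(p) = 0.
    The same holds for every G-invariant polynomial, characteristic zero
    allowing division by |G| (fixed_constant_mod).

    Choose e in R such that phi(e) has trivial stabiliser
    (exists_free_combination), and put Q(t) = prod over s <> 1 of (t - s e) and
    Delta = Q(e).  Since Q(g e) = 0 for g <> 1,
      Delta f = sum over g of Q(g e) (g f)
              = sum over k of Q_k Tr(f e^k)          (discriminant_mul_trace).
    If phi(f) = 0 all these traces are in I, so Delta f is in I.  The norm N of
    Delta is an invariant multiple of Delta, hence N f is in I and N is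
    congruent modulo I to the constant phi(N), the norm of phi(Delta), which is
    nonzero because the conjugates of phi(e) are distinct.  Therefore f is in
    I (sol_eval_ker). *)

(** * Ideals given by finitely many generators *)

Section IdealSpan.
Context {R : comNzRingType} {r : nat}.
Implicit Types (h : 'I_r -> R) (f g : R).

Definition ideal_span h f : Prop := exists c : 'I_r -> R, f = \sum_k c k * h k.

Lemma ideal_span0 h : ideal_span h 0.
Proof. by exists (fun=> 0); rewrite big1 // => k _; rewrite mul0r. Qed.

Lemma ideal_spanD h f g :
  ideal_span h f -> ideal_span h g -> ideal_span h (f + g).
Proof.
move=> [c ->] [d ->]; exists (fun k => c k + d k).
by rewrite -big_split; apply: eq_bigr => k _; rewrite mulrDl.
Qed.

Lemma ideal_spanMl h f g : ideal_span h f -> ideal_span h (g * f).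
Proof.
move=> [c ->]; exists (fun k => g * c k).
by rewrite mulr_sumr; apply: eq_bigr => k _; rewrite mulrA.
Qed.

Lemma ideal_spanMr h f g : ideal_span h f -> ideal_span h (f * g).
Proof. by rewrite mulrC; apply: ideal_spanMl. Qed.

Lemma ideal_spanB h f g :
  ideal_span h f -> ideal_span h g -> ideal_span h (f - g).
Proof.
by move=> hf hg; rewrite -mulN1r; apply/ideal_spanD/ideal_spanMl.
Qed.

Lemma ideal_span_sum h (I : Type) (s : seq I) (E : I -> R) :
  (forall i, ideal_span h (E i)) -> ideal_span h (\sum_(i <- s) E i).
Proof.
move=> hE; elim/big_ind: _ => //; first exact: ideal_span0.
by move=> f g; apply: ideal_spanD.
Qed.

Lemma ideal_span_gen h k : ideal_span h (h k).
Proof.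
exists (fun j => (j == k)%:R); rewrite (bigD1 k) //= eqxx mul1r.
by rewrite big1 ?addr0 // => j /negPf->; rewrite mul0r.
Qed.

End IdealSpan.

(** * Polynomials congruent to a constant *)

Section ConstantModulo.
Context {F : fieldType} {n r : nat}.
Implicit Types (h : 'I_r -> {mpoly F[n]}) (p q : {mpoly F[n]}).

Definition constant_mod h p : Prop := exists c : F, ideal_span h (p - c%:MP).

Lemma constant_modC h c : constant_mod h c%:MP.
Proof. by exists c; rewrite subrr; apply: ideal_span0. Qed.

Lemma constant_modD h p q :
  constant_mod h p -> constant_mod h q -> constant_mod h (p + q).
Proof.
move=> [c hc] [d hd]; exists (c + d).
by rewrite mpolyCD opprD addrACA; apply: ideal_spanD.
Qed.

Lemma constant_modM h p q :
  constant_mod h p -> constant_mod h q -> constant_mod h (p * q).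
Proof.
move=> [c hc] [d hd]; exists (c * d).
have -> : p * q - (c * d)%:MP = (p - c%:MP) * q + c%:MP * (q - d%:MP).
  by rewrite mpolyCM mulrBl mulrBr addrA subrK.
by apply: ideal_spanD; [apply: ideal_spanMr | apply: ideal_spanMl].
Qed.

Lemma constant_mod_sum h (I : Type) (s : seq I) (E : I -> {mpoly F[n]}) :
  (forall i, constant_mod h (E i)) -> constant_mod h (\sum_(i <- s) E i).
Proof.
move=> hE; elim/big_ind: _ => //.
  by rewrite -mpolyC0; apply: constant_modC.
by move=> f g; apply: constant_modD.
Qed.

Lemma constant_mod_prod h (I : Type) (s : seq I) (E : I -> {mpoly F[n]}) :
  (forall i, constant_mod h (E i)) -> constant_mod h (\prod_(i <- s) E i).
Proof.
move=> hE; elim/big_ind: _ => //.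
  by rewrite -mpolyC1; apply: constant_modC.
by move=> f g; apply: constant_modM.
Qed.

Lemma constant_modX h p m : constant_mod h p -> constant_mod h (p ^+ m).
Proof.
move=> hp; elim: m => [|m IH].
  by rewrite expr0 -mpolyC1; apply: constant_modC.
by rewrite exprS; apply: constant_modM.
Qed.

End ConstantModulo.

(** * Linear substitutions *)

(** Identities between substitutions and evaluations reduce to the variables
    by this uniqueness. *)
Lemma mpoly_rmorph_eq {k : nat} {A : nzRingType} {S : comNzRingType}
    (u v : {rmorphism {mpoly A[k]} -> S}) :
  (forall c, u c%:MP = v c%:MP) -> (forall i, u 'X_i = v 'X_i) -> u =1 v.
Proof.
move=> uvC uvX p; rewrite [p]mpolyE !raddf_sum; apply: eq_bigr => m _ /=.
rewrite -mul_mpolyC !rmorphM /= uvC mpolyXE_id !rmorph_prod; congr (_ * _).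
by apply: eq_bigr => i _; rewrite !rmorphXn uvX.
Qed.

HB.instance Definition _ (C : fieldType) (n : nat) :=
  GRing.RMorphism.copy (@incl_mpoly C n) (map_mpoly (@ratconst C)).
HB.instance Definition _ (C : fieldType) (n : nat) (M : 'M[C]_n) :=
  GRing.RMorphism.copy (lin_act M)
    (comp_mpoly [tuple \sum_j ratconst (M i j) *: 'X_j | i < n]).
HB.instance Definition _ (C : fieldType) (K : splittingFieldType (ratfun C))
    (n : nat) (y : 'I_n -> K) :=
  GRing.RMorphism.copy (sol_eval y) (mmap (in_alg K) y).

Section LinearSubstitution.
Context {C : fieldType} {n : nat}.

Lemma lin_actC (M : 'M[C]_n) (c : ratfun C) : lin_act M c%:MP = c%:MP.
Proof. exact: comp_mpolyC. Qed.

Lemma lin_actX (M : 'M[C]_n) (i : 'I_n) :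
  lin_act M 'X_i = \sum_j ratconst (M i j) *: 'X_j.
Proof. by rewrite /lin_act comp_mpolyXU -tnth_nth tnth_mktuple. Qed.

Lemma lin_act1 (p : {mpoly (ratfun C)[n]}) : lin_act 1%:M p = p.
Proof.
rewrite /lin_act (_ : [tuple _ | i < n] = [tuple 'X_i | i < n]).
  exact: comp_mpoly_id.
apply: eq_from_tnth => i; rewrite !tnth_mktuple (bigD1 i) //= mxE eqxx rmorph1.
rewrite scale1r big1 ?addr0 // => j ji.
by rewrite mxE eq_sym (negPf ji) rmorph0 scale0r.
Qed.

Lemma lin_act_mul (M N : 'M[C]_n) (p : {mpoly (ratfun C)[n]}) :
  lin_act M (lin_act N p) = lin_act (N *m M) p.
Proof.
pose u : {rmorphism _ -> _} := lin_act M \o lin_act N.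
apply: (mpoly_rmorph_eq u (lin_act (N *m M))) => [c|i] /=.
  by rewrite !lin_actC.
rewrite !lin_actX raddf_sum /=.
under eq_bigr => j _ do
  rewrite -mul_mpolyC rmorphM /= lin_actC lin_actX mul_mpolyC scaler_sumr.
rewrite exchange_big; apply: eq_bigr => k _ /=.
rewrite mxE rmorph_sum scaler_suml; apply: eq_bigr => j _.
by rewrite scalerA rmorphM.
Qed.

(** The action preserves the C-form C[X_1, ..., X_n] of the polynomial ring:
    this is what brings the trace of a monomial into C[X]^G. *)
Lemma lin_act_incl (M : 'M[C]_n) (p : {mpoly C[n]}) :
  lin_act M (incl_mpoly p) =
    incl_mpoly (p \mPo [tuple \sum_j M i j *: 'X_j | i < n]).
Proof.
pose u : {rmorphism _ -> _} := lin_act M \o @incl_mpoly C n.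
pose v : {rmorphism _ -> _} := @incl_mpoly C n \o
  comp_mpoly [tuple \sum_j M i j *: 'X_j | i < n].
apply: (mpoly_rmorph_eq u v) => [c|i] /=.
  by rewrite comp_mpolyC /incl_mpoly map_mpolyC lin_actC.
rewrite comp_mpolyXU -tnth_nth tnth_mktuple /incl_mpoly map_mpolyX lin_actX.
rewrite rmorph_sum; apply: eq_bigr => j _ /=.
by rewrite map_mpolyZ map_mpolyX.
Qed.

End LinearSubstitution.

(** * The Galois group *)

Section CharacteristicZeroGalois.
Context {F : fieldType} (charF : [pchar F] =i pred0) {K : splittingFieldType F}.

Lemma separable_element_pchar0 (E : {subfield K}) x : separable_element E x.
Proof. by apply: pcharf0_separable => p; rewrite pchar_lalg charF. Qed.

Lemma gal_alg (g : gal_of {:K}) (c : F) : g c%:A = c%:A.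
Proof. by rewrite linearZ /= rmorph1. Qed.

Lemma gal_fixed_in1 (x : K) : (forall g : gal_of {:K}, g x = x) -> x \in 1%VS.
Proof.
move=> gx; have /galois_fixedField <- : galois 1%AS {:K}.
  apply/and3P; split; [exact: subvf | | exact: normalFieldf].
  by apply/separableP => z _; apply: separable_element_pchar0.
by apply/fixedFieldP => [|g _]; [exact: memvf | exact: gx].
Qed.

End CharacteristicZeroGalois.

Section DifferentialGalois.
Context {C : fieldType} (charC : [pchar C] =i pred0).
Context {K : splittingFieldType (ratfun C)}.

Lemma pchar_ratfun : [pchar ratfun C] =i pred0.
Proof. by move=> p; rewrite -charC; apply: (fmorph_pchar (@ratconst C)). Qed.

Lemma gal_constK (g : gal_of {:K}) (c : C) : g (constK K c) = constK K c.
Proof. exact: gal_alg. Qed.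

(** The difference of two extensions is a derivation that vanishes on C(z),
    and such a derivation kills every separable element. *)
Lemma derivation_extension_unique (D1 D2 : K -> K) :
  extends_dz D1 -> extends_dz D2 -> D1 =1 D2.
Proof.
move=> [D1D D1M D1f] [D2D D2M D2f].
pose d x := D1 x - D2 x.
have dM x z : d (x * z) = d x * z + x * d z.
  by rewrite /d D1M D2M mulrBl mulrBr opprD addrACA.
have dL : linear d.
  move=> c x z; have -> : d (c *: x + z) = d (c%:A * x) + d z.
    by rewrite mulr_algl /d D1D D2D opprD addrACA.
  by rewrite dM {1}/d D1f D2f subrr mul0r add0r mulr_algl.
pose dlin : {linear K -> K} := HB.pack d (GRing.isLinear.Build _ _ _ _ d dL).
have dE x : linfun dlin x = d x by rewrite lfunE.
move=> x; apply/eqP; rewrite -subr_eq0 -/(d x) -dE -memv_ker.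
have /Derivation_separableP/(_ (linfun dlin)) : separable_element 1%AS x.
  exact/separable_element_pchar0/pchar_ratfun.
move=> sep; apply: (subvP (sep _ _) x (memv_adjoin _ _)).
  by apply/allrelP => u v _ _; rewrite !dE dM.
(* d 1 = d (1 * 1) = d 1 + d 1 *)
rewrite -memvE memv_ker dE; apply/eqP.
by apply: (addrI (d 1)); rewrite addr0 -{3}[1]mulr1 dM mulr1 mul1r.
Qed.

(** Conjugating D by g gives another extension of d/dz. *)
Lemma gal_derivation_commute (D : K -> K) (g : gal_of {:K}) x :
  extends_dz D -> g (D x) = D (g x).
Proof.
move=> extD; have [DD DM Df] := extD.
have gVK z : g (g^-1%g z) = z by rewrite -galM ?memvf // mulVg gal_id.
have gKV z : g^-1%g (g z) = z by rewrite -galM ?memvf // mulgV gal_id.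
suff ext : extends_dz (fun z => g^-1%g (D (g z))).
  by rewrite (derivation_extension_unique _ _ extD ext) gVK.
split=> [z t|z t|c].
- by rewrite rmorphD DD rmorphD.
- by rewrite rmorphM DM rmorphD !rmorphM /= !gKV.
- by rewrite gal_alg Df gal_alg.
Qed.

(** The elements fixed by g form a subfield that contains the solutions and,
    as g commutes with D, their derivatives; so it is all of K. *)
Lemma gal_trivial_on_solutions (D : K -> K) n (a : 'I_n -> ratfun C)
    (y : 'I_n -> K) (g : gal_of {:K}) :
  extends_dz D -> generated_by_solutions D a -> solution_basis D a y ->
  (forall i, g (y i) = y i) -> g = 1%g.
Proof.
move=> extD gen [_ _ span_y] gy.
have fullE : fixedField [set g] = fullv.
  apply: (gen [aspace of fixedField [set g]]) => v /span_y[c ->] k.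
  apply/fixedFieldP => [|_ /set1P->]; first exact: memvf.
  elim: k => [|k IH] /=; last by rewrite gal_derivation_commute // IH.
  by rewrite rmorph_sum; apply: eq_bigr => i _; rewrite rmorphM /= gal_constK gy.
apply/eqP/gal_eqP => x _; rewrite gal_id.
have [_] : x \in {:K}%VS /\ forall h, h \in [set g] -> h x = x.
  by apply: mem_fixedFieldP; rewrite fullE memvf.
by apply; apply/set1P.
Qed.

End DifferentialGalois.

(** * A combination with free orbit *)

Lemma natr_inj_pchar0 {F : fieldType} :
  [pchar F] =i pred0 -> injective (fun m => m%:R : F).
Proof.
move=> /pcharf0P char0 i j ij; wlog le_ij : i j ij / (i <= j)%N.
  by move=> W; case/orP: (leq_total i j) => [/W|/W/esym]; apply.
apply/eqP; rewrite eqn_leq le_ij -subn_eq0 -char0 natrB //.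
by move: ij => /= ->; rewrite subrr eqxx.
Qed.

Lemma exists_nat_nonroot {F : fieldType} (p : {poly F}) :
  [pchar F] =i pred0 -> p != 0 -> exists m : nat, p.[m%:R] != 0.
Proof.
move=> char0 p0; pose s := [seq m%:R : F | m <- iota 0 (size p)].
have /allPn[_ /mapP[m _ ->] pm] : ~~ all (root p) s; last by exists m.
apply/negP => ps; have /(max_poly_roots p0 ps) : uniq s.
  by rewrite map_inj_uniq ?iota_uniq //; apply: natr_inj_pchar0.
by rewrite size_map size_iota ltnn.
Qed.

(** For g <> 1 the polynomial W g = sum over i of (g (y i) - y i) t^i is
    nonzero, and t in F is a root of it exactly when g fixes the combination
    sum over i of t^i y i.  Any non-root of the product of the W g will do;
    it can be taken integral because the characteristic is zero. *)
Lemma exists_free_combination {F : fieldType} {K : splittingFieldType F} {n}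
    (y : 'I_n -> K) :
  [pchar F] =i pred0 ->
  (forall g : gal_of {:K}, (forall i, g (y i) = y i) -> g = 1%g) ->
  exists m : nat, forall g : gal_of {:K},
    g (\sum_(i < n) m%:R ^+ i * y i) = \sum_(i < n) m%:R ^+ i * y i -> g = 1%g.
Proof.
move=> charF free_y.
pose W (g : gal_of {:K}) := rVpoly (\row_i (g (y i) - y i)).
have W0 g : g != 1%g -> W g != 0.
  apply: contraNneq => Wg; apply/eqP/free_y => i.
  have /(congr1 (fun p : {poly K} => p`_i)) := Wg.
  by rewrite coef_rVpoly_ord mxE coef0 => /eqP; rewrite subr_eq0 => /eqP.
have charK : [pchar K] =i pred0 by move=> p; rewrite pchar_lalg charF.
have [|m] := exists_nat_nonroot (\prod_(g | g != 1%g) W g) charK.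
  by rewrite prodf_seq_neq0; apply/allP => g _; apply/implyP/W0.
rewrite horner_prod prodf_seq_neq0 => /allP Wm; exists m => g gm.
apply/eqP; apply: contraT => g1.
have /implyP/(_ g1)/eqP[] := Wm g (mem_index_enum g).
rewrite (horner_coef_wide _ (size_poly _ _)).
under eq_bigr => i _ do rewrite coef_rVpoly_ord mxE mulrBl.
rewrite sumrB; apply/eqP; rewrite subr_eq0; apply/eqP.
under [RHS]eq_bigr => i _ do rewrite mulrC.
rewrite -gm rmorph_sum; apply: eq_bigr => i _.
by rewrite rmorphM rmorphXn rmorph_nat mulrC.
Qed.

(** Q vanishes at every conjugate of e other than e itself, so
    Q(e) f = sum over g of Q(g e) (g f); expanding Q gives the traces. *)
Lemma discriminant_mul_trace {gT : finGroupType} {R : comNzRingType}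
    (act : gT -> {rmorphism R -> R}) (e f : R) :
  act 1%g =1 id ->
  let Q := \prod_(s | s != 1%g) ('X - (act s e)%:P) in
  Q.[e] * f = \sum_(k < size Q) Q`_k * \sum_g act g (f * e ^+ k).
Proof.
move=> act1 Q.
have Q0 g : g != 1%g -> Q.[act g e] = 0.
  by move=> g1; rewrite horner_prod (bigD1 g) //= hornerXsubC subrr mul0r.
transitivity (\sum_g Q.[act g e] * act g f).
  by rewrite (bigD1 1%g) //= !act1 big1 ?addr0 // => g /Q0->; rewrite mul0r.
under eq_bigr => g _ do rewrite horner_coef mulr_suml.
rewrite exchange_big; apply: eq_bigr => k _; rewrite mulr_sumr.
by apply: eq_bigr => g _; rewrite rmorphM rmorphXn -mulrA [act g f * _]mulrC.
Qed.

(** * The kernel of the evaluation *)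

Section KernelOfEvaluation.
Context {C : fieldType} (charC : [pchar C] =i pred0).
Context {K : splittingFieldType (ratfun C)} {n r : nat}.
Variables (y : 'I_n -> K) (G : {group gal_of {:K}}).
Variables (rho : gal_of {:K} -> 'M[C]_n) (P : r.-tuple {mpoly C[n]}).
Hypothesis full_G : forall g : gal_of {:K}, g \in G.
Hypothesis free_y :
  forall c : 'I_n -> C, \sum_i constK K (c i) * y i = 0 -> forall i, c i = 0.
Hypothesis repr_rho : represents y G rho.
Hypothesis faithful_y :
  forall g : gal_of {:K}, (forall i, g (y i) = y i) -> g = 1%g.
Hypothesis gens : homogeneous_generators G rho P.

Let h (k : 'I_r) := incl_mpoly (tnth P k) - (ev y (tnth P k))%:MP.

Lemma sol_evalC (c : ratfun C) : sol_eval y c%:MP = c%:A.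
Proof. exact: mmapC. Qed.

Lemma sol_evalX i : sol_eval y 'X_i = y i.
Proof. by rewrite /sol_eval mmapX mmap1U. Qed.

Lemma constK_coord_inj (c d : 'I_n -> C) :
  \sum_i constK K (c i) * y i = \sum_i constK K (d i) * y i -> c =1 d.
Proof.
move=> /eqP; rewrite -subr_eq0 -sumrB => /eqP cd i; apply/eqP.
rewrite -subr_eq0; apply/eqP; move: i; apply: (free_y (fun i => c i - d i)).
rewrite -[RHS]cd; apply: eq_bigr => i _.
by rewrite /constK raddfB scalerBl mulrBl.
Qed.

Lemma gal_sol (g : gal_of {:K}) i :
  g (y i) = \sum_j constK K (rho g i j) * y j.
Proof. exact: (repr_rho _ (full_G g)). Qed.

Lemma rho1 : rho 1%g = 1%:M.
Proof.
apply/matrixP => i; apply: constK_coord_inj.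
rewrite -gal_sol gal_id (bigD1 i) //= mxE eqxx /constK rmorph1 scale1r mul1r.
rewrite big1 ?addr0 // => j; rewrite eq_sym mxE => /negPf->.
by rewrite rmorph0 scale0r mul0r.
Qed.

(** The product g * s of gal_of applies g first, which is why the factors keep
    their order; y is linearly independent over C, so matrices can be compared
    entrywise. *)
Lemma rhoM (g s : gal_of {:K}) : rho (g * s)%g = rho g *m rho s.
Proof.
apply/matrixP => i; apply: constK_coord_inj.
rewrite -gal_sol galM ?memvf // gal_sol rmorph_sum.
under eq_bigr => j _ do rewrite rmorphM /= gal_constK gal_sol mulr_sumr.
rewrite exchange_big; apply: eq_bigr => k _ /=.
rewrite mxE /constK rmorph_sum scaler_suml mulr_suml; apply: eq_bigr => j _.
by rewrite mulrA mulr_algl rmorphM scalerA.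
Qed.

Lemma sol_eval_act g p : sol_eval y (lin_act (rho g) p) = g (sol_eval y p).
Proof.
pose u : {rmorphism _ -> _} := sol_eval y \o lin_act (rho g).
pose v : {rmorphism {mpoly (ratfun C)[n]} -> K} := gal_repr g \o sol_eval y.
apply: (mpoly_rmorph_eq u v) => [c|i] /=.
  by rewrite lin_actC sol_evalC gal_alg.
rewrite lin_actX rmorph_sum sol_evalX gal_sol; apply: eq_bigr => j _ /=.
by rewrite -mul_mpolyC rmorphM /= sol_evalC sol_evalX.
Qed.

(** P_k is invariant, so its value is fixed by the whole Galois group and lies
    in C(z); there ev reads it off faithfully. *)
Lemma sol_eval_generator k : sol_eval y (h k) = 0.
Proof.
rewrite rmorphB /= sol_evalC to_baseK ?subrr //.
apply: (gal_fixed_in1 (pchar_ratfun charC)) => g.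
have inv : Defs.invariant G rho (tnth P k).
  by have [_ gen] := gens; apply/gen; exists 'X_k; rewrite comp_mpolyXU -tnth_nth.
by rewrite -sol_eval_act [lin_act _ _](inv g (full_G g)).
Qed.

Lemma sol_eval_ideal p : ideal_span h p -> sol_eval y p = 0.
Proof.
move=> [c ->]; rewrite rmorph_sum big1 // => k _.
by rewrite rmorphM /= sol_eval_generator mulr0.
Qed.

Lemma constant_mod_sol_eval p :
  constant_mod h p -> exists2 c, sol_eval y p = c%:A & ideal_span h (p - c%:MP).
Proof.
move=> [c hc]; exists c => //; move: (sol_eval_ideal _ hc).
by rewrite rmorphB /= sol_evalC => /eqP; rewrite subr_eq0 => /eqP.
Qed.

Lemma constant_mod_ker p :
  constant_mod h p -> sol_eval y p = 0 -> ideal_span h p.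
Proof.
move=> /constant_mod_sol_eval[c -> hc] /eqP.
rewrite scaler_eq0 oner_eq0 orbF => /eqP c0.
by move: hc; rewrite c0 mpolyC0 subr0.
Qed.

(** Each P_k is congruent to a constant, hence so is any polynomial in them. *)
Lemma invariant_constant_mod p :
  Defs.invariant G rho p -> constant_mod h (incl_mpoly p).
Proof.
have [_ gen] := gens; move=> /gen[q ->].
rewrite comp_mpolyE rmorph_sum; apply: constant_mod_sum => m /=.
rewrite -mul_mpolyC rmorphM /=; apply: constant_modM.
  by rewrite /incl_mpoly map_mpolyC; apply: constant_modC.
rewrite rmorph_prod; apply: constant_mod_prod => k /=.
rewrite rmorphXn /=; apply: constant_modX.
by exists (ev y (tnth P k)); apply: ideal_span_gen.
Qed.

Definition act_trace p := \sum_g lin_act (rho g) p.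

Lemma lin_act_trace g p : lin_act (rho g) (act_trace p) = act_trace p.
Proof.
rewrite /act_trace rmorph_sum [RHS](reindex_inj (mulIg g)).
by apply: eq_bigr => s _; rewrite /= lin_act_mul rhoM.
Qed.

(** The trace is linear over C(z), which reduces the claim to a monomial; the
    trace of a monomial has coefficients in C and is invariant. *)
Lemma act_trace_constant_mod p : constant_mod h (act_trace p).
Proof.
have -> : act_trace p = \sum_(m <- msupp p) (p@_m)%:MP * act_trace 'X_[m].
  rewrite /act_trace; under [RHS]eq_bigr => m _ do rewrite mulr_sumr.
  rewrite [RHS]exchange_big; apply: eq_bigr => g _ /=.
  rewrite [p in LHS]mpolyE rmorph_sum; apply: eq_bigr => m _ /=.
  by rewrite -mul_mpolyC rmorphM /= lin_actC.
apply: constant_mod_sum => m; apply: constant_modM; first exact: constant_modC.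
pose avg : {mpoly C[n]} :=
  \sum_g ('X_[m] \mPo [tuple \sum_j rho g i j *: 'X_j | i < n]).
have avgE : act_trace 'X_[m] = incl_mpoly avg.
  rewrite rmorph_sum; apply: eq_bigr => g _.
  by rewrite /= -lin_act_incl /incl_mpoly map_mpolyX.
rewrite avgE; apply: invariant_constant_mod => g _.
by rewrite -avgE lin_act_trace.
Qed.

Lemma sol_eval_act_trace p :
  sol_eval y p = 0 -> sol_eval y (act_trace p) = 0.
Proof.
move=> p0; rewrite rmorph_sum big1 // => g _ /=.
by rewrite sol_eval_act p0 rmorph0.
Qed.

(** An invariant p is 1/N times its trace, where N is the order of the group. *)
Lemma fixed_constant_mod p :
  (forall g, lin_act (rho g) p = p) -> constant_mod h p.
Proof.
move=> fix_p; pose N := #|{: gal_of {:K}}|.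
have N0 : N%:R != 0 :> ratfun C.
  move/pcharf0P: (pchar_ratfun charC) => ->.
  by rewrite -lt0n; apply/card_gt0P; exists 1%g.
have -> : p = (N%:R^-1)%:MP * act_trace p.
  rewrite /act_trace (eq_bigr (fun=> p)) // sumr_const -[p *+ _]mulr_natl mulrA.
  by rewrite -mpolyC_nat -mpolyCM mulVf // mpolyC1 mul1r.
by apply: constant_modM; [apply: constant_modC | apply: act_trace_constant_mod].
Qed.

Lemma sol_eval_ker f : sol_eval y f = 0 -> ideal_span h f.
Proof.
move=> f0.
have [m free_m] := exists_free_combination y (pchar_ratfun charC) faithful_y.
pose e : {mpoly (ratfun C)[n]} := \sum_(i < n) m%:R ^+ i * 'X_i.
have eval_e : sol_eval y e = \sum_(i < n) m%:R ^+ i * y i.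
  rewrite rmorph_sum; apply: eq_bigr => i _ /=.
  by rewrite rmorphM rmorphXn rmorph_nat /= sol_evalX.
pose act g : {rmorphism _ -> _} := lin_act (rho g).
have act1 : act 1%g =1 id by move=> p; rewrite /act /= rho1 lin_act1.
have := discriminant_mul_trace act e f act1.
set Q := \prod_(s | _) _ => /=; set D := Q.[e] => DfE.
have IDf : ideal_span h (D * f).
  rewrite DfE; apply: ideal_span_sum => k; apply: ideal_spanMl.
  apply: constant_mod_ker; first exact: act_trace_constant_mod.
  by apply: sol_eval_act_trace; rewrite rmorphM /= f0 mul0r.
have D0 : sol_eval y D != 0.
  rewrite /D horner_prod rmorph_prod prodf_seq_neq0; apply/allP => s _.
  apply/implyP => s1; rewrite hornerXsubC rmorphB /= sol_eval_act eval_e.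
  by rewrite subr_eq0 eq_sym; apply: contra_neq s1; apply: free_m.
pose N := \prod_g lin_act (rho g) D.
have [|c NE IN] := constant_mod_sol_eval N.
  apply: fixed_constant_mod => g.
  rewrite /N rmorph_prod [RHS](reindex_inj (mulIg g)).
  by apply: eq_bigr => s _; rewrite /= lin_act_mul rhoM.
have c0 : c != 0.
  have : sol_eval y N != 0.
    rewrite rmorph_prod prodf_seq_neq0; apply/allP => g _ /=.
    by rewrite sol_eval_act fmorph_eq0.
  by rewrite NE scaler_eq0 oner_eq0 orbF.
have INf : ideal_span h (N * f).
  rewrite /N (bigD1 1%g) //= rho1 lin_act1 mulrAC; exact: ideal_spanMr.
(* N is congruent to the nonzero constant c modulo the ideal *)
have -> : f = (c^-1)%:MP * (N * f - (N - c%:MP) * f).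
  by rewrite -mulrBl opprB addrC subrK mulrA -mpolyCM mulVf // mpolyC1 mul1r.
by apply/ideal_spanMl/ideal_spanB => //; apply: ideal_spanMr.
Qed.

End KernelOfEvaluation.

Theorem corollary4p2 (C : closedFieldType) (charC : [pchar C] =i pred0)
  (n : nat) (a : 'I_n -> ratfun C)
  (K : splittingFieldType (ratfun C)) (D : K -> K)
  (PV : picard_vessiot D a)
  (G : {group gal_of {:K}}) (diffGal : diff_galois_group D G)
  (y : 'I_n -> K) (basis_y : solution_basis D a y)
  (rho : gal_of {:K} -> 'M[C]_n) (repr_rho : represents y G rho)
  (r : nat) (P : r.-tuple {mpoly C[n]})
  (gens : homogeneous_generators G rho P)
  (f : {mpoly (ratfun C)[n]}) :
  sol_eval y f = 0 <->
  exists c : 'I_r -> {mpoly (ratfun C)[n]},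
    f = \sum_(k < r) c k * (incl_mpoly (tnth P k) - (ev y (tnth P k))%:MP).
Proof.
have [extD gen_D _] := PV.
have full_G g : g \in G.
  by apply/diffGal => x; apply: (gal_derivation_commute charC).
have faithful_y (g : gal_of {:K}) : (forall i, g (y i) = y i) -> g = 1%g.
  exact: (gal_trivial_on_solutions charC) extD gen_D basis_y.
have [_ free_y _] := basis_y.
split; last exact: (sol_eval_ideal charC y G rho P full_G repr_rho gens).
exact: (sol_eval_ker charC y G rho P full_G free_y repr_rho faithful_y gens).
Qed.
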